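(* There is a function $f:\mathbb{Z}_{>0}\to\mathbb{R}$ with $f(t)\in\mathcal{O}(t^{20})$ (in particular $f$ is bounded by a polynomial in $t$) such that the following holds. For every positive integer $t$ and every class $\mathcal{C}$ of graphs of twin-width at most $2$ such that no $G\in\mathcal{C}$ contains $K_{t,t}$ as a subgraph, every $G\in\mathcal{C}$ has tree-width at most $f(t)$.
   Context: All graphs are finite and simple (no loops, no multiple edges). ''Subgraph'' means not necessarily induced subgraph. $K_{t,t}$ is the complete bipartite graph with both sides of size $t$. Tree-width is the usual notion (minimum over tree-decompositions of the maximum bag size minus one). Trigraph: a simple graph $G$ in which some edges are marked red (the other edges are black). ''Neighbour'' and $N_G(x)$ refer to all edges (red and black); $N^r_G(x)$ denotes the set of red neighbours of $x$, and the red degree of $x$ is $|N_G^r(x)|$. A contraction of a pair of distinct (not necessarily adjacent) vertices $x_1,x_2$ of a trigraph $G$ produces the trigraph $G'$ that is the same as $G$ except that $x_1,x_2$ are replaced by one new vertex $x_0$ with $N_{G'}(x_0)=(N_G(x_1)\cup N_G(x_2))\setminus\{x_1,x_2\}$ and $N^r_{G'}(x_0)=\big(N^r_G(x_1)\cup N^r_G(x_2)\cup (N_G(x_1)\,\Delta\, N_G(x_2))\big)\setminus\{x_1,x_2\}$, where $\Delta$ is symmetric difference. A contraction sequence of a trigraph $G$ is a sequence of successive contractions turning $G$ into a single vertex; its width is the maximum red degree of any vertex in any trigraph of the sequence. The twin-width of $G$ is the minimum width over all contraction sequences of $G$. For an ordinary graph $G$, these notions are applied to $G$ viewed as a trigraph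 with no red edges. *)

(* Defs.v *)
From mathcomp Require Import all_boot.
From mathcomp Require Import boolp.

Set Implicit Arguments.
Unset Strict Implicit.
Unset Printing Implicit Defensive.

(* [ex_minn] for an arbitrary predicate; the value is 0 if nothing satisfies P,
   which for [twin_width] below happens only for the graph with no vertex. *)
Definition least (P : nat -> Prop) : nat :=
  if pselect (exists n, `[< P n >]) is left exP then ex_minn exP else 0.

Lemma leastP (P : nat -> Prop) :
  (exists n, P n) -> P (least P) /\ (forall m, P m -> least P <= m).
Proof.
move=> [n Pn]; rewrite /least; case: pselect => [exP|nP]; last first.
  by case: nP; exists n; apply/asboolP.
case: ex_minnP => m /asboolP Pm minm; split=> // k Pk.
by apply: minm; apply/asboolP.
Qed.

Record sgraph := SGraph {
  vertex :> finType;
  adj : rel vertex;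
  adj_sym : symmetric adj;
  adj_irr : irreflexive adj }.

Definition is_subgraph (H G : sgraph) : Prop :=
  exists2 phi : H -> G, injective phi &
    forall x y : H, adj x y -> adj (phi x) (phi y).

Section CompleteBipartite.
Variable t : nat.

Definition bip_adj (u v : 'I_t + 'I_t) : bool :=
  match u, v with
  | inl _, inr _ | inr _, inl _ => true
  | _, _ => false
  end.

Fact bip_adj_sym : symmetric bip_adj. Proof. by case=> ? []. Qed.
Fact bip_adj_irr : irreflexive bip_adj. Proof. by case. Qed.

Definition complete_bipartite : sgraph := SGraph bip_adj_sym bip_adj_irr.
End CompleteBipartite.

Definition is_connected (G : sgraph) : Prop :=
  forall x y : G, connect (@adj G) x y.

Definition is_acyclic (G : sgraph) : Prop :=
  forall c : seq G, 2 < size c -> ~ ucycle (@adj G) c.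

Definition is_tree (G : sgraph) : Prop :=
  [/\ 0 < #|G|, is_connected G & is_acyclic G].

Record tree_decomposition (G : sgraph) := TreeDecomposition {
  td_tree : sgraph;
  td_bag : td_tree -> {set G};
  td_treeP : is_tree td_tree;
  td_vertex : forall x : G, exists i, x \in td_bag i;
  td_edge : forall x y : G, adj x y ->
    exists i, (x \in td_bag i) && (y \in td_bag i);
  td_subtree : forall (x : G) (i j : td_tree),
    x \in td_bag i -> x \in td_bag j ->
    connect [rel k l | [&& adj k l, x \in td_bag k & x \in td_bag l]] i j }.

(* The predecessor truncates: the graph with no vertex gets tree-width 0, not -1. *)
Definition td_width (G : sgraph) (D : tree_decomposition G) : nat :=
  (\max_(i : td_tree D) #|td_bag i|).-1.

Definition tree_width (G : sgraph) : nat :=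
  least (fun w => exists D : tree_decomposition G, td_width D = w).

Lemma tree_decomposition_exists (G : sgraph) : inhabited (tree_decomposition G).
Proof.
have irr : irreflexive (fun _ _ : unit => false) by [].
have sym : symmetric (fun _ _ : unit => false) by [].
pose T := SGraph sym irr.
have treeT : is_tree T.
  split; first by rewrite card_unit.
  - by case=> [] []; exact: connect0.
  - by case=> [|[] [|[] c]].
have v (x : G) : exists i : T, x \in [set: G] by exists tt; rewrite inE.
have e (x y : G) : adj x y -> exists i : T, (x \in [set: G]) && (y \in [set: G]).
  by exists tt; rewrite !inE.
split; apply: (@TreeDecomposition G T (fun=> [set: G]) treeT v e).
by move=> x [] [] _ _; exact: connect0.
Qed.

Record trigraph := Trigraph {
  tri_graph :> sgraph;
  red : rel tri_graph;
  red_sym : symmetric red;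
  red_adj : subrel red (@adj tri_graph) }.

Definition nbr (G : trigraph) (x : G) : {set G} := [set y | adj x y].
Definition red_nbr (G : trigraph) (x : G) : {set G} := [set y | red x y].

Definition max_red_degree (G : trigraph) : nat := \max_(x : G) #|red_nbr x|.

Definition symdiff (T : finType) (A B : {set T}) : {set T} :=
  (A :\: B) :|: (B :\: A).

(* The contraction of x1 and x2 has vertex set V(G) \ {x1, x2} plus the new
   vertex None. *)
Section Contraction.
Variables (G : trigraph) (x1 x2 : G).

Definition contract_vertex : finType :=
  option {z : G | (z != x1) && (z != x2)}.

Definition contract_nbr : {set G} := nbr x1 :|: nbr x2.

Definition contract_red_nbr : {set G} :=
  red_nbr x1 :|: red_nbr x2 :|: symdiff (nbr x1) (nbr x2).

Definition contract_adj (u v : contract_vertex) : bool :=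
  match u, v with
  | Some a, Some b => adj (val a) (val b)
  | None, Some a | Some a, None => val a \in contract_nbr
  | None, None => false
  end.

Definition contract_red (u v : contract_vertex) : bool :=
  match u, v with
  | Some a, Some b => red (val a) (val b)
  | None, Some a | Some a, None => val a \in contract_red_nbr
  | None, None => false
  end.

Fact contract_adj_sym : symmetric contract_adj.
Proof. by case=> [a|] [b|] //=; exact: adj_sym. Qed.

Fact contract_adj_irr : irreflexive contract_adj.
Proof. by case=> [a|] //=; exact: adj_irr. Qed.

Fact contract_red_sym : symmetric contract_red.
Proof. by case=> [a|] [b|] //=; exact: red_sym. Qed.

Fact contract_red_nbr_sub : contract_red_nbr \subset contract_nbr.
Proof.
apply/subsetP => z; rewrite !inE => /orP[/orP[]/red_adj ->|]; rewrite ?orbT //.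
by case: (adj x1 z); case: (adj x2 z).
Qed.

Fact contract_red_adj : subrel contract_red contract_adj.
Proof.
by case=> [a|] [b|] //=; [exact: red_adj| |]; exact/subsetP/contract_red_nbr_sub.
Qed.

Definition contract : trigraph :=
  @Trigraph (SGraph contract_adj_sym contract_adj_irr) contract_red
            contract_red_sym contract_red_adj.
End Contraction.

Inductive contraction_seq : trigraph -> Type :=
| cseq_end (G : trigraph) : #|G| = 1 -> contraction_seq G
| cseq_step (G : trigraph) (x1 x2 : G) :
    x1 != x2 -> contraction_seq (contract x1 x2) -> contraction_seq G.

Fixpoint cseq_width (G : trigraph) (s : contraction_seq G) : nat :=
  match s with
  | cseq_end H _ => max_red_degree H
  | cseq_step H _ _ _ s' => maxn (max_red_degree H) (cseq_width s')
  end.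

Section TrigraphOfGraph.
Variable G : sgraph.

Definition no_red (_ _ : G) : bool := false.

Fact no_red_sym : symmetric no_red. Proof. by []. Qed.
Fact no_red_adj : subrel no_red (@adj G). Proof. by []. Qed.

Definition trigraph_of : trigraph := Trigraph no_red_sym no_red_adj.
End TrigraphOfGraph.

Definition twin_width_tri (G : trigraph) : nat :=
  least (fun w => exists s : contraction_seq G, cseq_width s = w).

Definition twin_width (G : sgraph) : nat := twin_width_tri (trigraph_of G).

Lemma card_contract (G : trigraph) (x1 x2 : G) :
  x1 != x2 -> #|contract x1 x2|.+1 = #|G|.
Proof.
move=> x12; rewrite /= card_option card_sig.
rewrite -(cardsC [set x1; x2]) cards2 x12 !addSn add0n; congr _.+2.
by apply: eq_card => z; rewrite !inE negb_or.
Qed.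

Lemma contraction_seq_exists (G : trigraph) :
  0 < #|G| -> inhabited (contraction_seq G).
Proof.
move En : #|G| => n; elim: n G En => // n IH G En _.
case: (posnP n) => [n0|n_gt0]; first by split; apply: cseq_end; rewrite En n0.
have /card_gt1P[x1 [x2 [_ _ x12]]] : 1 < #|G| by rewrite En ltnS.
have [|s] := IH (contract x1 x2) _ n_gt0.
  by apply: succn_inj; rewrite card_contract.
by split; exact: cseq_step x12 s.
Qed.

(* Main.v *)
(* It suffices to find, for every vertex set W of some fixed size K, a set of
   s = 23t < K/9 vertices which splits W in a balanced way; recursively separating
   gives tree-width at most K + s.  A contraction sequence of width 2 is a sequence
   of vertex partitions whose parts are each "mixed" (neither complete nor
   anticomplete) with at most two others.  Stop when a part A first contains
   about a ninth of W.  Since no K_{t,t} occurs, every part with at least t vertices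
   has fewer than t neighbours outside the parts it is mixed with, so A can be
   left only along two red paths, and it remains to cut a red path F, D, C, E of
   large parts by O(t) vertices.  For this undo the merges one at a time: the degree
   bound forces a split part to leave at most one strand of the path, the other
   half being irrelevant, complete to D or C, or itself part of a longer red path,
   of which one end is then forgotten while subsets of D and C are kept. *)

Require Import Defs.
From mathcomp Require Import all_boot zify.

Set Implicit Arguments.
Unset Strict Implicit.
Unset Printing Implicit Defensive.

(** * Partition sequences *)

Section CompleteAndMixed.
Variable G : sgraph.
Implicit Types A B C X Y : {set G}.

Definition complete A B := [forall a in A, forall b in B, adj a b].
Definition anticomplete A B := [forall a in A, forall b in B, ~~ adj a b].
Definition mixed A B := ~~ complete A B && ~~ anticomplete A B.

Lemma completeP A B :
  reflect (forall a b, a \in A -> b \in B -> adj a b) (complete A B).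
Proof.
by apply: (iffP 'forall_in_forall_inP) => h a; [move=> b aA; apply: h | move=> aA b; apply: h].
Qed.

Lemma anticompleteP A B :
  reflect (forall a b, a \in A -> b \in B -> ~~ adj a b) (anticomplete A B).
Proof.
by apply: (iffP 'forall_in_forall_inP) => h a; [move=> b aA; apply: h | move=> aA b; apply: h].
Qed.

Lemma complete_sym A B : complete A B = complete B A.
Proof. by apply/completeP/completeP => h a b aA bB; rewrite adj_sym h. Qed.

Lemma anticomplete_sym A B : anticomplete A B = anticomplete B A.
Proof. by apply/anticompleteP/anticompleteP => h a b aA bB; rewrite adj_sym h. Qed.

Lemma mixed_sym A B : mixed A B = mixed B A.
Proof. by rewrite /mixed complete_sym anticomplete_sym. Qed.

Lemma completeS A A' B B' :
  A' \subset A -> B' \subset B -> complete A B -> complete A' B'.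
Proof.
move=> /subsetP sA /subsetP sB /completeP h; apply/completeP => a b aA bB.
by apply: h; [apply: sA | apply: sB].
Qed.

Lemma anticompleteS A A' B B' :
  A' \subset A -> B' \subset B -> anticomplete A B -> anticomplete A' B'.
Proof.
move=> /subsetP sA /subsetP sB /anticompleteP h; apply/anticompleteP => a b aA bB.
by apply: h; [apply: sA | apply: sB].
Qed.

Lemma mixedS A A' B B' :
  A' \subset A -> B' \subset B -> mixed A' B' -> mixed A B.
Proof.
by move=> sA sB /andP[c a]; apply/andP; split; [apply: contra c|apply: contra a];
  [apply: completeS|apply: anticompleteS].
Qed.

Lemma mixed_neq0 A B : mixed A B -> exists a, a \in A.
Proof.
move=> /andP[_ /anticompleteP h]; apply/set0Pn; apply/eqP => A0.
by apply: h => a b; rewrite A0 inE.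
Qed.

(** Two sets complete to each other are disjoint, since adjacency is irreflexive, so [t] vertices of
    each would span $K_{t,t}$. The forbidden subgraph enters the proof only through this bound. *)
Lemma complete_card t A B :
  ~ is_subgraph (complete_bipartite t) G -> complete A B -> t <= #|B| -> #|A| < t.
Proof.
move=> noK /completeP cAB tB; rewrite ltnNge; apply/negP => tA; apply: noK.
have dAB a : a \in A -> a \in B -> False.
  by move=> aA aB; have := cAB a a aA aB; rewrite adj_irr.
exists (fun u : 'I_t + 'I_t => match u with
        | inl i => enum_val (widen_ord tA i) | inr i => enum_val (widen_ord tB i) end).
  have inA i := enum_valP (widen_ord tA i); have inB i := enum_valP (widen_ord tB i).
  move=> [i|i] [j|j] //= E.
  - by congr inl; move/enum_val_inj: E => /(congr1 val) /= /val_inj.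
  - by case: (dAB _ (inA i)); rewrite E.
  - by case: (dAB _ (inA j)); rewrite -E.
  - by congr inr; move/enum_val_inj: E => /(congr1 val) /= /val_inj.
move=> [i|i] [j|j] //= _; last rewrite adj_sym; exact: cAB (enum_valP _) (enum_valP _).
Qed.

End CompleteAndMixed.

Section Merging.
Variable G : sgraph.
Implicit Types (P Q : {set {set G}}) (A B C D E F X L : {set G}).

(** The empty set is allowed as a part, so that fibres of a map need not be shown nonempty; it is
    mixed with nothing. *)
Definition good P := [&& cover P == [set: G], trivIset P &
  [forall A in P, #|[set B in P | (B != A) && mixed A B]| <= 2]].

Lemma good_part P v : good P -> exists2 A, A \in P & v \in A.
Proof.
case/and3P => /eqP cP _ _; have : v \in cover P by rewrite cP inE.
by case/bigcupP => A; exists A.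
Qed.

Lemma good_disjoint P A B v : good P -> A \in P -> B \in P -> A != B ->
  v \in A -> v \in B -> False.
Proof.
case/and3P => _ /trivIsetP tP _ AP BP AB vA vB.
by have /pred0P/(_ v) := tP _ _ AP BP AB; rewrite /= vA vB.
Qed.

Lemma good_degree P A B1 B2 B3 : good P ->
  A \in P -> B1 \in P -> B2 \in P -> B3 \in P -> uniq [:: A; B1; B2; B3] ->
  mixed A B1 -> mixed A B2 -> ~~ mixed A B3.
Proof.
case/and3P => _ _ /forall_inP dP AP B1P B2P B3P.
rewrite /= !inE !negb_or => /and4P[/and3P[n1 n2 n3] /andP[n12 n13] n23 _] m1 m2.
apply/negP => m3; have := dP A AP; apply/negP; rewrite -ltnNge.
have sub : [set B1; B2; B3] \subset [set B in P | (B != A) && mixed A B].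
  apply/subsetP => B; rewrite !inE => /orP[/orP[]|] /eqP->;
  by rewrite ?(B1P, B2P, B3P, m1, m2, m3) andbT /= eq_sym.
apply: leq_trans (subset_leq_card sub).
by rewrite -setUA cardsU1 cards2 !inE negb_or n12 n13 n23.
Qed.

(** Induction on a derivation undoes the merges, the last one first. [A = B] is permitted; every
    part of [Q] is then a part of [P]. *)
Inductive reachable : {set {set G}} -> Prop :=
| reach_singletons : reachable [set [set x] | x in G]
| reach_merge P Q A B : reachable P -> A \in P -> B \in P ->
    (forall C, C \in Q -> C \in P \/ C = A :|: B) -> good Q -> reachable Q.

Lemma mixed_singletons (x y : G) : ~~ mixed [set x] [set y].
Proof.
rewrite /mixed; case xy: (adj x y); first have -> // : complete [set x] [set y].
  by apply/completeP => a b /set1P-> /set1P->.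
have -> : anticomplete [set x] [set y]; last by rewrite andbF.
by apply/anticompleteP => a b /set1P-> /set1P->; rewrite xy.
Qed.

Lemma good_singletons : good [set [set x] | x in G].
Proof.
apply/and3P; split.
- apply/eqP/setP => x; rewrite inE; apply/bigcupP; exists [set x]; last exact: set11.
  by apply/imsetP; exists x.
- apply/trivIsetP => _ _ /imsetP[x _ ->] /imsetP[y _ ->] xy.
  by rewrite disjoints1 inE; apply: contra xy => /eqP->.
- apply/forall_inP => _ /imsetP[x _ ->].
  rewrite eq_card0 // => B; rewrite !inE.
  by apply/negP => /and3P[/imsetP[y _ ->] _]; apply/negP/mixed_singletons.
Qed.

Lemma reachable_good P : reachable P -> good P.
Proof. by case=> //; exact: good_singletons. Qed.

End Merging.

(** * Cutting a red path *)

Section Cut.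
Variables (G : sgraph) (t : nat).
Hypothesis noK : ~ is_subgraph (complete_bipartite t) G.
Implicit Types (P Q : {set {set G}}) (A B C D E F X L Y : {set G}).

Definition big A := t <= #|A|.

Lemma complete_small A B : big B -> complete A B -> #|A| < t.
Proof. by move=> bB cAB; exact: complete_card noK cAB bB. Qed.

(** Completeness would give $K_{t,t}$, so between big sets not being mixed already means having no
    edges. *)
Lemma big_anticomplete A B : big A -> big B -> ~~ mixed A B -> anticomplete A B.
Proof.
rewrite /mixed negb_and !negbK => bA bB /orP[cAB|//].
by have := complete_small bB cAB; rewrite ltnNge => /negP[].
Qed.

(** The deletion that makes a set harmless to a big set it is not mixed with: nothing if it is big,
    all of it, fewer than [t] vertices, if it is small. *)
Definition small_part A := if big A then set0 else A.

Lemma small_part_card A : #|small_part A| <= t.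
Proof.
by rewrite /small_part; case: ifP => [|/negbT]; rewrite ?cards0 // /big -ltnNge => /ltnW.
Qed.

Lemma small_part_anticomplete A B : big B -> ~~ (big A && mixed A B) ->
  anticomplete (A :\: small_part A) B.
Proof.
move=> bB; rewrite /small_part; case: ifP => [bA /= nm|_ _].
  by rewrite setD0; exact: big_anticomplete.
by rewrite setDv; apply/anticompleteP => a b; rewrite inE.
Qed.

(* X0 is paid for once; XD and XC have fewer than t elements because they are
   complete to big subsets D0 and C0 which only shrink as merges are undone. *)
Definition cut F D C E := exists X0 XD XC D0 C0 L : {set G},
  let X := X0 :|: XD :|: XC in let U := F :|: D :|: C :|: E in
  [/\ [/\ #|X0| <= t.*2, D0 \subset D & C0 \subset C],
      [/\ big D0, big C0, complete XD D0 & complete XC C0],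
      forall u, u \in F -> u \notin X -> u \in L,
      forall u, u \in E -> u \notin X -> u \notin L &
      forall u v, u \in U -> v \in U -> u \notin X -> v \notin X ->
        u \in L -> v \notin L -> ~~ adj u v].

(** The bound is [2t + t + t]. The sizes of [XD] and [XC] are counted only here, however many sets
    the induction has added to them. *)
Lemma cut_separator F D C E : cut F D C E -> exists X L : {set G},
  [/\ #|X| <= 4 * t,
      forall u, u \in F -> u \notin X -> u \in L,
      forall u, u \in E -> u \notin X -> u \notin L &
      forall u v, u \in F :|: D :|: C :|: E -> v \in F :|: D :|: C :|: E ->
        u \notin X -> v \notin X -> u \in L -> v \notin L -> ~~ adj u v].
Proof.
move=> [X0 [XD [XC [D0 [C0 [L [[c0 _ _] [bD bC cD cC] hF hE hU]]]]]]].
exists (X0 :|: XD :|: XC), L; split=> //.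
have := complete_small bD cD; have := complete_small bC cC.
have := cardsU (X0 :|: XD) XC; have := cardsU X0 XD; lia.
Qed.

Lemma cut_sym F D C E : cut F D C E -> cut E C D F.
Proof.
move=> [X0 [XD [XC [D0 [C0 [L [[c0 sD sC] [bD bC cD cC] hF hE hU]]]]]]].
have eX : X0 :|: XC :|: XD = X0 :|: XD :|: XC by rewrite setUAC.
have eU : E :|: C :|: D :|: F = F :|: D :|: C :|: E.
  by apply/setP => u; rewrite !inE; do !case: (u \in _).
exists X0, XC, XD, C0, D0, (~: L); rewrite /= eX eU; split=> //.
- by move=> u uE uX; rewrite inE hE.
- by move=> u uF uX; rewrite inE negbK hF.
- by move=> u v uU vU uX vX; rewrite !inE negbK adj_sym => uL vL; apply: hU.
Qed.

(** The case where no further merge has to be undone: [XD] and [XC] start empty, with [D0 = D] and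
    [C0 = C]. *)
Lemma cut_direct F D C E X L : big D -> big C -> #|X| <= t.*2 ->
  (forall u, u \in F -> u \notin X -> u \in L) ->
  (forall u, u \in E -> u \notin X -> u \notin L) ->
  (forall u v, u \in F :|: D :|: C :|: E -> v \in F :|: D :|: C :|: E ->
     u \notin X -> v \notin X -> u \in L -> v \notin L -> ~~ adj u v) ->
  cut F D C E.
Proof.
move=> bD bC cX hF hE hU; exists X, set0, set0, D, C, L; rewrite /= !setU0; split=> //.
by split=> //; apply/completeP => a b; rewrite inE.
Qed.

(* Y goes into the separator if it is complete to D or C1 and otherwise joins the
   side of E1; when the red path gets longer, Y is the end that is forgotten. *)
Lemma cut_extend F D C E C1 E1 Y :
  cut F D C1 E1 -> C1 \subset C -> C \subset C1 :|: E1 :|: Y -> E \subset E1 :|: Y ->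
  (forall u, u \in F -> u \notin Y) ->
  [|| complete Y D, complete Y C1 | anticomplete (F :|: D :|: C1) Y] ->
  cut F D C E.
Proof.
move=> [X0 [XD [XC [D0 [C0 [L [[c0 sD sC] [bD bC cD cC] hF hE hU]]]]]]].
move=> sC1 sCY sEY FY hY.
(* At most one of [ZD] and [ZC] is [Y] and the rest is empty, so that the three cases are treated
   together. *)
have [ZD [ZC [cZD cZC aZ]]] : exists ZD ZC : {set G}, [/\ complete ZD D, complete ZC C1
    & anticomplete (F :|: D :|: C1) (Y :\: (ZD :|: ZC))].
  have c0S A : complete set0 A by apply/completeP => a b; rewrite inE.
  have aS0 A : anticomplete A set0 by apply/anticompleteP => a b _; rewrite inE.
  case/or3P: hY => h; [exists Y, set0|exists set0, Y|exists set0, set0];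
  by rewrite ?(setU0, set0U, setDv, setD0).
exists X0, (XD :|: ZD), (XC :|: ZC), D0, C0, (L :\: Y); rewrite /=.
set X := X0 :|: XD :|: XC in hF hE hU *.
have -> : X0 :|: (XD :|: ZD) :|: (XC :|: ZC) = X :|: (ZD :|: ZC).
  by rewrite /X; apply/setP => u; rewrite !inE; do !case: (u \in _).
split.
- by split=> //; exact: subset_trans sC1.
- split=> //; apply/completeP => a b /setUP[aX|aY] b0.
  + exact: (completeP _ _ cD).
  + by apply: (completeP _ _ cZD) => //; exact: (subsetP sD).
  + exact: (completeP _ _ cC).
  + by apply: (completeP _ _ cZC) => //; exact: (subsetP sC).
- by move=> u uF; rewrite in_setU => /norP[uX _]; rewrite in_setD FY //= hF.
- move=> u uE; rewrite in_setU => /norP[uX _]; rewrite in_setD negb_and negbK.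
  by have /setUP[uE1|->//] := subsetP sEY u uE; rewrite hE // orbT.
have inU u : u \in F :|: D :|: C :|: E -> u \notin Y -> u \in F :|: D :|: C1 :|: E1.
  move=> + uY; move: (subsetP sCY u) (subsetP sEY u); rewrite !inE (negbTE uY) !orbF.
  by do !case: (u \in _) => //=; auto.
move=> u v uU vU; rewrite !(in_setU _ X) => /norP[uX _] /norP[vX vZ].
rewrite !in_setD negb_and negbK => /andP[uY uL].
have u1 := inU u uU uY.
have [vY _|vY /= vL] := boolP (v \in Y); last exact: hU (inU v vU vY) uX vX uL vL.
apply: (anticompleteP _ _ aZ); last by rewrite in_setD vZ vY.
(* Edges between [E1] and [Y] are harmless: [u] lies in [L], hence not in [E1]. *)
by case/setUP: u1 => // uE; move: uL; rewrite (negbTE (hE u uE uX)).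
Qed.

(** An induced path on four big parts in the graph of mixed pairs; since the parts are big,
    non-consecutive ones have no edges between them. *)
Definition window F D C E :=
  [/\ uniq [:: F; D; C; E], [/\ big F, big D, big C & big E],
      [/\ mixed F D, mixed D C & mixed C E] &
      [/\ ~~ mixed F C, ~~ mixed D E & ~~ mixed F E]].

Lemma window_sym F D C E : window F D C E -> window E C D F.
Proof.
move=> [u [bF bD bC bE] [m1 m2 m3] [n1 n2 n3]]; split=> //.
- by rewrite -(rev_uniq [:: _; _; _; _]).
- by rewrite !(mixed_sym E, mixed_sym C D, mixed_sym D F).
- by rewrite !(mixed_sym E, mixed_sym C F).
Qed.

Lemma disjoint_neq Q A D E : good Q -> D \in Q -> E \in Q -> D != E ->
  A \subset E -> 0 < #|D| -> D != A.
Proof.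
move=> gQ DQ EQ DE sAE /card_gt0P[d dD]; apply/eqP => DA.
by apply: (good_disjoint gQ DQ EQ DE dD); rewrite DA in dD; exact: (subsetP sAE).
Qed.

Lemma mixed_card A B : mixed A B -> 0 < #|A|.
Proof. by move=> /mixed_neq0[a aA]; apply/card_gt0P; exists a. Qed.

Lemma nonmixedP A B : ~~ mixed A B -> anticomplete A B \/ complete B A.
Proof. by rewrite /mixed negb_and !negbK complete_sym => /orP[|]; [right|left]. Qed.

Lemma small_parts_card A B : #|small_part A :|: small_part B| <= t.*2.
Proof.
have := cardsU (small_part A) (small_part B).
have := small_part_card A; have := small_part_card B; lia.
Qed.

(** A big half that is not mixed with [X] has no edges to it, and a small half is deleted. *)
Lemma small_parts_anticomplete A B X : big X -> ~~ (big A && mixed X A) ->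
  ~~ (big B && mixed X B) ->
  let S := small_part A :|: small_part B in anticomplete (X :\: S) ((A :|: B) :\: S).
Proof.
rewrite (mixed_sym X A) (mixed_sym X B) /= => bX nA nB; rewrite anticomplete_sym.
apply/anticompleteP => a x; rewrite inE in_setU negb_or => /andP[/andP[aA aB] aAB] /setDP[xX _].
case/setUP: aAB => ain.
- by apply: (anticompleteP _ _ (small_part_anticomplete bX nA)); rewrite // inE aA.
- by apply: (anticompleteP _ _ (small_part_anticomplete bX nB)); rewrite // inE aB.
Qed.

(** In a window only [C] among the other parts can have edges to [E]; once [X] destroys these, [E]
    is cut off. *)
Lemma cut_around_end Q F D C E X : good Q -> F \in Q -> E \in Q ->
  window F D C E -> #|X| <= t.*2 -> anticomplete (C :\: X) (E :\: X) -> cut F D C E.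
Proof.
move=> gQ FQ EQ [u [bF bD bC bE] _ [n1 n2 n3]] cX /anticompleteP nCE.
move: (u); rewrite /= !inE !negb_or => /and4P[/and3P[_ _ FE] _ _ _].
apply: (@cut_direct _ _ _ _ X (~: E)) => //.
- by move=> v vF _; rewrite inE; apply/negP; exact: good_disjoint gQ FQ EQ FE vF.
- by move=> v vE _; rewrite inE vE.
move=> v w vU _ vX wX; rewrite in_setC => vE; rewrite in_setC negbK => wE.
case/setUP: vU => [/setUP[/setUP[]|]|] vin.
- exact: (anticompleteP _ _ (big_anticomplete bF bE n3)).
- exact: (anticompleteP _ _ (big_anticomplete bD bE n2)).
- by apply: nCE; rewrite inE ?vX ?wX.
- by rewrite vin in vE.
Qed.

(** Here the path is broken between [D] and [C], the only parts with edges across the middle. *)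
Lemma cut_around_middle Q F D C E X : good Q -> F \in Q -> D \in Q -> E \in Q ->
  window F D C E -> #|X| <= t.*2 -> anticomplete (D :\: X) (C :\: X) -> cut F D C E.
Proof.
move=> gQ FQ DQ EQ [u [bF bD bC bE] _ [n1 n2 n3]] cX /anticompleteP nDC.
move: (u); rewrite /= !inE !negb_or => /and4P[/and3P[_ _ FE] /andP[_ DE] _ _].
apply: (@cut_direct _ _ _ _ X (F :|: D)) => //.
- by move=> v vF _; rewrite inE vF.
- move=> v vE _; rewrite inE; apply/negP => /orP[vF|vD].
  + exact: good_disjoint gQ FQ EQ FE vF vE.
  + exact: good_disjoint gQ DQ EQ DE vD vE.
move=> v w _ wU vX wX vFD wFD.
have /orP[wC|wE] : (w \in C) || (w \in E) by move: wU wFD; rewrite !inE; do !case: (w \in _).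
all: case/setUP: vFD => vin.
- exact: (anticompleteP _ _ (big_anticomplete bF bC n1)).
- by apply: nDC; rewrite inE ?vX ?wX.
- exact: (anticompleteP _ _ (big_anticomplete bF bE n3)).
- exact: (anticompleteP _ _ (big_anticomplete bD bE n2)).
Qed.

Section Split.
Variables (P Q : {set {set G}}) (A B : {set G}).
Hypotheses (gP : good P) (gQ : good Q) (AP : A \in P) (BP : B \in P) (AB : A != B)
  (ABQ : A :|: B \in Q).
Hypothesis IH : forall F D C E, F \in P -> D \in P -> C \in P -> E \in P ->
  window F D C E -> cut F D C E.

(** [C] is mixed with [D] and [A], so not with [B]. Hence [F, D, C, A] is a window before the merge,
    and [B] is either complete to [C] and absorbed by the separator, or without edges to [F], [D],
    [C] and kept on the side of [A]. *)
Lemma split_end_one F D C : F \in P -> D \in P -> C \in P ->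
  F \in Q -> D \in Q -> C \in Q -> window F D C (A :|: B) ->
  big A -> mixed C A -> cut F D C (A :|: B).
Proof.
move=> FP DP CP FQ DQ CQ [u [bF bD bC bE] [m1 m2 m3] [n1 n2 n3]] bA mCA.
have [sA sB] : A \subset A :|: B /\ B \subset A :|: B by rewrite subsetUl subsetUr.
move: (u); rewrite /= !inE !negb_or => /and4P[/and3P[FD FC FE] /andP[DC DE] CE _].
have F0 := mixed_card m1; have D0 := mixed_card m2; have C0 := mixed_card m3.
have FA := disjoint_neq gQ FQ ABQ FE sA F0; have DA := disjoint_neq gQ DQ ABQ DE sA D0.
have CA := disjoint_neq gQ CQ ABQ CE sA C0; have CB := disjoint_neq gQ CQ ABQ CE sB C0.
have DB := disjoint_neq gQ DQ ABQ DE sB D0.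
have mCB : ~~ mixed C B.
  apply: (good_degree gP CP DP AP BP) => //; last by rewrite mixed_sym.
  by rewrite /= !inE !negb_or AB (eq_sym C) DC CA CB DA DB.
have cutA : cut F D C A.
  apply: IH => //; split=> //.
    by rewrite /= !inE !negb_or FD FC DC FA DA CA.
  by split=> //; [apply: contra n2|apply: contra n3]; exact: mixedS.
apply: (cut_extend (Y := B) cutA); rewrite ?subxx //.
- by rewrite -setUA subsetUl.
- by move=> v vF; apply/negP => vB; apply: (good_disjoint gQ FQ ABQ FE vF); rewrite inE vB orbT.
case: (nonmixedP mCB) => [aCB|->]; last by rewrite orbT.
apply/or3P/Or33/anticompleteP => a b /setUP[/setUP[]|] ain bB.
- by apply: (anticompleteP _ _ (big_anticomplete bF bE n3)) => //; exact: (subsetP sB).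
- by apply: (anticompleteP _ _ (big_anticomplete bD bE n2)) => //; exact: (subsetP sB).
- exact: (anticompleteP _ _ aCB).
Qed.


(** [D] is mixed with [F] and [A], so not with [B]. The cases are how the red path continues from
    [A]: directly to [E], through [B] to [E], or not at all. *)
Lemma split_middle_one F D C E : F \in P -> D \in P -> E \in P ->
  F \in Q -> D \in Q -> E \in Q -> window F D (A :|: B) E ->
  big A -> mixed D A -> cut F D (A :|: B) E.
Proof.
move=> FP DP EP FQ DQ EQ w bA mDA; move: (w) => [u [bF bD bC bE] [m1 m2 m3] [n1 n2 n3]].
have [sA sB] : A \subset A :|: B /\ B \subset A :|: B by rewrite subsetUl subsetUr.
move: (u); rewrite /= !inE !negb_or => /and4P[/and3P[FD FC FE] /andP[DC DE] CE _].
have F0 := mixed_card m1; have D0 := mixed_card m2; have E0 : 0 < #|E|.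
  by rewrite mixed_sym in m3; exact: mixed_card m3.
rewrite eq_sym in CE.
have FA := disjoint_neq gQ FQ ABQ FC sA F0; have DA := disjoint_neq gQ DQ ABQ DC sA D0.
have EA := disjoint_neq gQ EQ ABQ CE sA E0; have EB := disjoint_neq gQ EQ ABQ CE sB E0.
have DB := disjoint_neq gQ DQ ABQ DC sB D0; have FB := disjoint_neq gQ FQ ABQ FC sB F0.
have F_B v : v \in F -> v \notin B.
  by move=> vF; apply/negP => vB; apply: (good_disjoint gQ FQ ABQ FC vF); rewrite inE vB orbT.
have nDB : ~~ mixed D B.
  apply: (good_degree gP DP FP AP BP) => //; last by rewrite mixed_sym.
  by rewrite /= !inE !negb_or AB (eq_sym D) FD DA DB FA FB.
have aFC := anticompleteP _ _ (big_anticomplete bF bC n1).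
have aFE := anticompleteP _ _ (big_anticomplete bF bE n3).
have aDE := anticompleteP _ _ (big_anticomplete bD bE n2).
have uA : uniq [:: F; D; A; E] by rewrite /= !inE !negb_or FD FE DE FA DA (eq_sym A) EA.
(* If [A] takes the place of the merged part, its mixed neighbours are [D] and [E], so [B] is a
   strand off the path. *)
have [mEA|nEA] := boolP (mixed A E).
  have nAB : ~~ mixed A B.
    apply: (good_degree gP AP DP EP BP) => //; last by rewrite mixed_sym.
    by rewrite /= !inE !negb_or !(eq_sym A) DA EA (eq_sym B) AB DE DB EB.
  have cutA : cut F D A E.
    by apply: IH => //; split=> //; split=> //; apply: contra n1; exact: mixedS.
  apply: (cut_extend (Y := B) cutA); rewrite ?subsetUl ?F_B //.
    by rewrite setUAC subsetUl.
  have [aDB|->] := nonmixedP nDB; last by [].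
  have [aAB|->] := nonmixedP nAB; last by rewrite orbT.
  apply/or3P/Or33/anticompleteP => a b /setUP[/setUP[]|] ain bB.
  - by apply: aFC => //; exact: (subsetP sB).
  - exact: (anticompleteP _ _ aDB).
  - exact: (anticompleteP _ _ aAB).
have aAE := big_anticomplete bA bE nEA.
(* If neither half is both big and mixed with [E], deleting the small halves detaches [E]. *)
have [/andP[bB mEB]|nEB] := boolP (big B && mixed E B); last first.
  apply: (cut_around_end gQ FQ EQ w (small_parts_card A B)).
  rewrite anticomplete_sym; apply: small_parts_anticomplete => //.
  by rewrite mixed_sym (negbTE nEA) andbF.
have aDB := big_anticomplete bD bB nDB.
(* The red path before the merge is [F, D, A, B, E]: the window [F, D, A, B] is cut and [E] is put
   on the side of [B]. *)
have [mAB|nAB] := boolP (mixed A B).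
  have cutAB : cut F D A B.
    apply: IH => //; split=> //.
    - by rewrite /= !inE !negb_or FD FA FB DA DB AB.
    - by split=> //; apply: contra n1; exact: mixedS.
  apply: (cut_extend (Y := E) cutAB sA); rewrite ?subsetUl ?subsetUr //.
    by move=> v vF; apply/negP; exact: good_disjoint gQ FQ EQ FE vF.
  apply/or3P/Or33/anticompleteP => a b /setUP[/setUP[]|] ain bB'.
  - exact: aFE.
  - exact: aDE.
  - exact: (anticompleteP _ _ aAE).
(* The path is already broken between [A] and [B], so nothing is deleted. *)
have aAB := big_anticomplete bA bB nAB.
apply: (@cut_direct _ _ _ _ set0 (F :|: D :|: A)) => //.
- by rewrite cards0.
- by move=> v vF _; rewrite !inE vF.
- move=> v vE _; rewrite !inE; apply/negP => /orP[/orP[vF|vD]|vA].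
  + exact: good_disjoint gQ FQ EQ FE vF vE.
  + exact: good_disjoint gQ DQ EQ DE vD vE.
  + by apply: (good_disjoint gQ EQ ABQ CE vE); exact: (subsetP sA).
move=> v x _ xU _ _ vin xin.
have /orP[xB|xE] : (x \in B) || (x \in E).
  by move: xU xin; rewrite !inE; do !case: (x \in _).
all: case/setUP: vin => [/setUP[]|] vin.
- by apply: aFC => //; exact: (subsetP sB).
- exact: (anticompleteP _ _ aDB).
- exact: (anticompleteP _ _ aAB).
- exact: aFE.
- exact: aDE.
- exact: (anticompleteP _ _ aAE).
Qed.

End Split.

(** [cut] does not mention the partition, so a cut found before a merge still serves after it if the
    merged part is outside the window. Otherwise the merged part is, up to reversal, [E] or [C]. *)
Lemma cut_window P F D C E : reachable P ->
  F \in P -> D \in P -> C \in P -> E \in P -> window F D C E -> cut F D C E.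
Proof.
move=> rP; elim: rP F D C E => {P} [|P Q A B rP IH AP BP QP gQ] F D C E.
  move=> /imsetP[x _ ->] /imsetP[y _ ->] _ _ [_ _ [m _ _] _].
  by have := mixed_singletons x y; rewrite m.
have gP := reachable_good rP.
have inP X : X \in Q -> X != A :|: B -> X \in P.
  by move=> /QP[//|->]; rewrite eqxx.
have split_end F' D' C' : A :|: B \notin P -> F' \in Q -> D' \in Q -> C' \in Q ->
    A :|: B \in Q -> window F' D' C' (A :|: B) -> cut F' D' C' (A :|: B).
  move=> nP FQ DQ CQ ABQ w; move: (w) => [u [_ _ bC _] _ _].
  move: (u); rewrite /= !inE !negb_or => /and4P[/and3P[_ _ FE] /andP[_ DE] CE _].
  have AB : A != B by apply: contra nP => /eqP <-; rewrite setUid.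
  have [/andP[bA mA]|nA] := boolP (big A && mixed C' A).
    by apply: (@split_end_one P Q) => //; exact: inP.
  have [/andP[bB mB]|nB] := boolP (big B && mixed C' B).
    rewrite setUC in ABQ w FE DE CE *.
    by apply: (@split_end_one P Q) => //; rewrite 1?eq_sym //; apply: inP; rewrite // setUC.
  apply: (cut_around_end gQ FQ ABQ w (small_parts_card A B)).
  exact: small_parts_anticomplete.
have split_middle F' D' E' : A :|: B \notin P -> F' \in Q -> D' \in Q -> E' \in Q ->
    A :|: B \in Q -> window F' D' (A :|: B) E' -> cut F' D' (A :|: B) E'.
  move=> nP FQ DQ EQ ABQ w; move: (w) => [u [_ bD _ _] _ _].
  move: (u); rewrite /= !inE !negb_or => /and4P[/and3P[_ FC _] /andP[DC _] CE _].
  rewrite eq_sym in CE.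
  have AB : A != B by apply: contra nP => /eqP <-; rewrite setUid.
  have [/andP[bA mA]|nA] := boolP (big A && mixed D' A).
    by apply: (@split_middle_one P Q) => //; exact: inP.
  have [/andP[bB mB]|nB] := boolP (big B && mixed D' B).
    rewrite setUC in ABQ w FC DC CE *.
    by apply: (@split_middle_one P Q) => //; rewrite 1?eq_sym //; apply: inP; rewrite // setUC.
  apply: (cut_around_middle gQ FQ DQ EQ w (small_parts_card A B)).
  exact: small_parts_anticomplete.
move=> FQ DQ CQ EQ w.
(* Trivial merges, including [A = B]: every part of [Q] is already in [P]. *)
have [ABP|nP] := boolP (A :|: B \in P).
  by apply: IH => //; [have [//|->] := QP _ FQ|have [//|->] := QP _ DQ
                      |have [//|->] := QP _ CQ|have [//|->] := QP _ EQ].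
have [eE|nE] := eqVneq E (A :|: B); first by rewrite eE in EQ w *; exact: split_end.
have [eC|nC] := eqVneq C (A :|: B); first by rewrite eC in CQ w *; exact: split_middle.
have [eD|nD] := eqVneq D (A :|: B).
  by apply: cut_sym; move/window_sym: w => w; rewrite eD in DQ w *; exact: split_middle.
have [eF|nF] := eqVneq F (A :|: B).
  by apply: cut_sym; move/window_sym: w => w; rewrite eF in FQ w *; exact: split_end.
by apply: IH => //; exact: inP.
Qed.

End Cut.

(** * Balanced separators *)

Lemma card_bigcup_leq (I T : finType) (M : {set I}) (F : I -> {set T}) n :
  (forall i, i \in M -> #|F i| <= n) -> #|\bigcup_(i in M) F i| <= #|M| * n.
Proof.
move=> Fn; rewrite -sum_nat_const.
elim/big_rec2: _ => [|i m A iM Am]; first by rewrite cards0.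
by apply: leq_trans (leq_card_setU _ _) _; exact: leq_add (Fn i iM) Am.
Qed.

Lemma good_degree_mem (G : sgraph) (P : {set {set G}}) A B1 B2 C : good P ->
  A \in P -> B1 \in P -> B2 \in P -> C \in P -> uniq [:: A; B1; B2] ->
  mixed A B1 -> mixed A B2 -> C != A -> mixed A C -> (C == B1) || (C == B2).
Proof.
move=> gP AP B1P B2P CP; rewrite /= !inE negb_or => /and3P[/andP[n1 n2] n12 _] m1 m2 CA mC.
apply/negP => /negP /norP[n3 n4].
have : ~~ mixed A C.
  apply: (good_degree gP AP B1P B2P CP) => //.
  by rewrite /= !inE !negb_or n1 n2 n12 !(eq_sym _ C) CA n3 n4.
by rewrite mC.
Qed.

Section Separator.
Variables (G : sgraph) (t : nat).
Hypothesis noK : ~ is_subgraph (complete_bipartite t) G.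
Implicit Types (P T : {set {set G}}) (A B C D L X W : {set G}).

Definition big_mixed_nbrs P A := [set B in P | [&& B != A, mixed A B & big t B]].

(* The vertices through which a big part B can be left other than to its big
   mixed neighbours. *)
Definition hull P B :=
  [set v | [forall b in B, adj v b]] :|:
  \bigcup_(C in [set C in P | (C != B) && mixed B C]) small_part t C.

(** Fewer than [t] vertices are complete to the big set [B], and each of at most two mixed
    neighbours contributes at most [t]. *)
Lemma hull_card P B : good P -> B \in P -> big t B -> #|hull P B| <= 3 * t.
Proof.
move=> gP BP bB; have /and3P[_ _ /forall_inP/(_ _ BP) dB] := gP.
have : #|[set v | [forall b in B, adj v b]]| < t.
  apply: (complete_small noK bB); apply/completeP => v b.
  by rewrite inE => /forall_inP; apply.
have := @card_bigcup_leq _ _ [set C in P | (C != B) && mixed B C] (small_part t) t.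
move=> /(_ (fun C _ => small_part_card t C)).
have := (leq_card_setU [set v | [forall b in B, adj v b]]
  (\bigcup_(C in [set C in P | (C != B) && mixed B C]) small_part t C)).1.
rewrite -/(hull P B); have := leq_mul dB (leqnn t); lia.
Qed.

(** Given an edge, the pair is complete, so that [v] is a common neighbour of [B], or mixed, and
    then a small [C] lies in the hull. *)
Lemma hull_or_big P B C b v : B \in P -> C \in P -> C != B -> b \in B -> v \in C ->
  adj b v -> v \in hull P B \/ C \in big_mixed_nbrs P B.
Proof.
move=> BP CP CB bB vC bv; have [mBC|/nonmixedP[/anticompleteP h|/completeP h]] := boolP (mixed B C).
- have [bC|sC] := boolP (big t C); first by right; rewrite inE CP CB mBC.
  left; rewrite inE; apply/orP; right; apply/bigcupP; exists C; first by rewrite inE CP CB.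
  by rewrite /small_part (negbTE sC).
- by move: bv; rewrite (negbTE (h _ _ bB vC)).
- by left; rewrite !inE; apply/orP; left; apply/forall_inP => b' b'B; exact: h.
Qed.

(* L is the stretch of the red path leaving A through B before X cuts it. *)
Definition arm P A B L X T :=
  [/\ T \subset P :\ A, #|T| <= 3, #|X| <= 10 * t, L \subset cover T &
    (forall u v, u \in L -> u \notin X -> v \notin X -> v \notin L -> v \notin A ->
       ~~ adj u v) /\
    (forall u v, u \in A -> u \notin X -> v \in B -> v \notin X -> v \notin L ->
       ~~ adj u v)].

(** The red path ends, or returns to [A], inside [T]. Without the hulls of its parts, the union of
    [T] can be left only towards [A]; three hulls cost [9t]. *)
Lemma arm_closed P A B T : good P -> T \subset P :\ A -> B \in T -> #|T| <= 3 ->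
  (forall D, D \in T -> big t D && (big_mixed_nbrs P D \subset A |: T)) ->
  exists L X T, arm P A B L X T.
Proof.
move=> gP TP BT T3 hT; exists (cover T), (\bigcup_(D in T) hull P D), T; split=> //.
  have : #|\bigcup_(D in T) hull P D| <= #|T| * (3 * t); last by nia.
  apply: card_bigcup_leq => D DT; have /andP[bD _] := hT D DT.
  by apply: hull_card => //; have := subsetP TP D DT; rewrite !inE => /andP[].
split=> [u v /bigcupP[D DT uD] _ vX vT vA|u v _ _ vB _ /bigcupP[]]; last by exists B.
apply/negP => uv; have [C CP vC] := good_part v gP.
have DP : D \in P by have := subsetP TP D DT; rewrite !inE => /andP[].
have CT : C \notin T by apply: contra vT => CT; apply/bigcupP; exists C.
have CD : C != D by apply: contra CT => /eqP->.
have [vh|CD'] := hull_or_big DP CP CD uD vC uv.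
  by case/negP: vX; apply/bigcupP; exists D.
have /andP[_ /subsetP/(_ _ CD')] := hT D DT; rewrite !inE (negbTE CT) orbF => /eqP CA.
by rewrite -CA vC in vA.
Qed.

(** The red path is followed from [A] through [B], [B2], [B3]. If it stops before [B3] or closes up
    at [A], the arm is closed; otherwise [A, B, B2, B3] is a window and can be cut. *)
Lemma arm_exists P A B : reachable P -> A \in P -> big t A ->
  B \in big_mixed_nbrs P A -> exists L X T, arm P A B L X T.
Proof.
move=> rP AP bA; rewrite inE => /and4P[BP BA mAB bB].
have gP := reachable_good rP.
have BA' : A != B by rewrite eq_sym.
have mBA : mixed B A by rewrite mixed_sym.
have [N0|[B2]] := set_0Vmem (big_mixed_nbrs P B :\ A).
  apply: (@arm_closed P A B [set B]) => //; rewrite ?cards1 ?set11 //.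
    by rewrite sub1set !inE BA.
  move=> D /set1P->; rewrite bB; apply/subsetP => C CN; rewrite !inE.
  by have := in_set0 C; rewrite -N0 in_setD1 CN andbT => /negbFE->.
rewrite !inE => /andP[B2A /and4P[B2P B2B mB2 bB2]].
have NB : big_mixed_nbrs P B \subset [set A; B2].
  apply/subsetP => C; rewrite !inE => /and4P[CP CB mC _].
  apply: (@good_degree_mem _ P B A B2 C) => //.
  by rewrite /= !inE !negb_or BA !(eq_sym _ B2) B2B B2A.
have [N0|[B3]] := set_0Vmem (big_mixed_nbrs P B2 :\: [set A; B]).
  apply: (@arm_closed P A B [set B; B2]) => //; rewrite ?cards2 ?set21 //.
  - by rewrite subUset !sub1set !inE BA B2A BP B2P.
  - by case: (_ != _).
  move=> D /set2P[->|->]; rewrite ?bB ?bB2.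
    apply: subset_trans NB _; apply/subsetP => C; rewrite !inE.
    by case/orP => ->; rewrite ?orbT.
  apply/subsetP => C CN; have := in_set0 C; rewrite -N0 in_setD CN andbT => /negbFE.
  by rewrite !inE => /orP[] ->; rewrite ?orbT.
rewrite !inE negb_or => /andP[/andP[B3A B3B] /and4P[B3P B32 mB3 bB3]].
have mB2B : mixed B2 B by rewrite mixed_sym.
have NB2 : big_mixed_nbrs P B2 \subset [set B; B3].
  apply/subsetP => C; rewrite !inE => /and4P[CP CB mC _].
  apply: (@good_degree_mem _ P B2 B B3 C) => //.
  by rewrite /= !inE !negb_or B2B !(eq_sym _ B3) B3B B32.
have nAB2 : ~~ mixed A B2.
  rewrite mixed_sym; apply: (good_degree gP B2P BP B3P AP) => //.
  by rewrite /= !inE !negb_or B2B B2A !(eq_sym _ B3) B32 B3B BA B3A.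
have [mAB3|nAB3] := boolP (mixed A B3).
  apply: (@arm_closed P A B (B |: [set B2; B3])) => //; rewrite ?set21 //.
  - by rewrite !subUset !sub1set !inE BA B2A B3A BP B2P.
  - by rewrite !inE eqxx.
  - by apply: leq_trans (leq_card_setU _ _) _; rewrite cards1 cards2; case: (_ != _).
  move=> D; rewrite !inE => /or3P[] /eqP->; rewrite ?bB ?bB2 ?bB3 /=.
  - apply: subset_trans NB _; apply/subsetP => C; rewrite !inE.
    by case/orP => ->; rewrite ?orbT.
  - apply: subset_trans NB2 _; apply/subsetP => C; rewrite !inE.
    by case/orP => ->; rewrite ?orbT.
  - apply/subsetP => C; rewrite !inE => /and4P[CP CB3 mC _].
    have : (C == B2) || (C == A).
      apply: (@good_degree_mem _ P B3 B2 A C) => //; first by rewrite /= !inE !negb_or B32 B3A B2A.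
      + by rewrite mixed_sym.
      + by rewrite mixed_sym.
    by case/orP => ->; rewrite ?orbT.
have nBB3 : ~~ mixed B B3.
  apply: (good_degree gP BP AP B2P B3P) => //.
  by rewrite /= !inE !negb_or !(eq_sym _ B2) !(eq_sym _ B3) B2B B2A B3A B3B BA B32.
have w : window t A B B2 B3.
  split=> //; rewrite /= !inE !negb_or !(eq_sym _ B2) !(eq_sym _ B3) B2B B2A B3A B3B B32.
  by rewrite BA'.
have [X1 [L1 [cX1 hA hB3 h1]]] := cut_separator noK (cut_window noK rP AP BP B2P B3P w).
(* The cost is [4t] for the window and [3t] for each hull, which gives the [10t] of [arm]. *)
pose X := X1 :|: hull P B :|: hull P B2.
have sX u : u \notin X -> [/\ u \notin X1, u \notin hull P B & u \notin hull P B2].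
  by rewrite !in_setU !negb_or => /andP[/andP[]].
exists (L1 :&: (B :|: B2)), X, [set B; B2]; split.
- by rewrite subUset !sub1set !inE BA B2A BP B2P.
- by rewrite cards2; case: (_ != _).
- rewrite (_ : 10 = 4 + 3 + 3) // !mulnDl.
  apply: leq_trans (leq_card_setU _ _).1 (leq_add _ (hull_card gP B2P bB2)).
  exact: leq_trans (leq_card_setU _ _).1 (leq_add cX1 (hull_card gP BP bB)).
- by apply: subset_trans (subsetIr _ _) _; rewrite /cover bigcup_setU !big_set1.
split=> u v; last first.
  move=> uA /sX[u1 _ _] vB /sX[v1 _ _]; rewrite !inE vB andbT => vL.
  by apply: h1; rewrite ?(inE, uA, vB, orbT) // hA.
rewrite in_setI => /andP[uL uBB] /sX[u1 uB uB2] /sX[v1 vB vB2] vL vA.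
apply/negP => uv; have [C CP vC] := good_part v gP.
have CA : C != A by apply: contra vA => /eqP <-.
have vB3L : v \in B3 -> v \notin L1 by move=> vB3; exact: hB3.
(* An edge from [B] or [B2] that avoids both hulls and [A] stays inside the window, where the cut
   applies. *)
have inU : v \in B :|: B2 :|: B3.
  have [CB|CB] := eqVneq C B; first by rewrite !inE -CB vC.
  have [CB2|CB2] := eqVneq C B2; first by rewrite !inE -CB2 vC orbT.
  case/setUP: uBB => uin.
    have [vh|/(subsetP NB)] := hull_or_big BP CP CB uin vC uv; first by rewrite vh in vB.
    by rewrite !inE (negbTE CA) (negbTE CB2).
  have [vh|/(subsetP NB2)] := hull_or_big B2P CP CB2 uin vC uv; first by rewrite vh in vB2.
  by rewrite !inE (negbTE CB) => /eqP <-; rewrite vC orbT.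
have vL1 : v \notin L1.
  move: inU; rewrite in_setU => /orP[vBB|/vB3L //].
  by move: vL; rewrite in_setI vBB andbT.
move: uv; apply/negP; apply: h1 => //.
- by move: uBB; rewrite !inE => /orP[] ->; rewrite ?orbT.
- by move: inU; rewrite !inE => /orP[/orP[]|] ->; rewrite ?orbT.
Qed.

(** At most two arms leave [A]: the cost is [3t] for its hull plus twice [10t], and the arms use at
    most twice three parts. *)
Lemma separator_around_part P A : reachable P -> A \in P -> big t A ->
  exists L X T, [/\ T \subset P :\ A, #|T| <= 6, #|X| <= 23 * t,
    A \subset L & L \subset A :|: cover T] /\
    forall u v, u \in L -> u \notin X -> v \notin X -> v \notin L -> ~~ adj u v.
Proof.
move=> rP AP bA; have gP := reachable_good rP.
pose M := big_mixed_nbrs P A.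
have M2 : #|M| <= 2.
  have /and3P[_ _ /forall_inP/(_ _ AP)] := gP; apply: leq_trans.
  apply: subset_leq_card; apply/subsetP => B; rewrite !inE.
  by case/and4P => -> -> ->.
have [f hf] : exists f : {set G} -> {set G} * {set G} * {set {set G}},
    forall B, B \in M -> arm P A B (f B).1.1 (f B).1.2 (f B).2.
  have [|f hf] := @fin_all_exists {set G} (fun=> ({set G} * {set G} * {set {set G}})%type)
    (fun B y => B \in M -> arm P A B y.1.1 y.1.2 y.2); last by exists f.
  move=> B; have [BM|BM] := boolP (B \in M); last by exists (set0, set0, set0).
  by have [L [X [T h]]] := arm_exists rP AP bA BM; exists (L, X, T).
pose LM := \bigcup_(B in M) (f B).1.1; pose XM := \bigcup_(B in M) (f B).1.2.
exists (A :|: LM), (hull P A :|: XM), (\bigcup_(B in M) (f B).2); split; first split.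
- by apply/bigcupsP => B /hf[].
- have : #|\bigcup_(B in M) (f B).2| <= #|M| * 3; last by nia.
  by apply: card_bigcup_leq => B /hf[].
- have : #|XM| <= #|M| * (10 * t) by apply: card_bigcup_leq => B /hf[].
  have := hull_card gP AP bA; have := (leq_card_setU (hull P A) XM).1; nia.
- exact: subsetUl.
- apply: setUS; apply/bigcupsP => B BM; have [_ _ _ sL _] := hf B BM.
  apply: subset_trans sL _; apply/bigcupsP => D DT; apply: bigcup_sup.
  by apply/bigcupP; exists B.
move=> u v; rewrite !(in_setU _ A) !(in_setU _ (hull P A)) !negb_or.
move=> uAL /andP[uh uX] /andP[vh vX] /andP[vA vL].
have XB B w : B \in M -> w \notin XM -> w \notin (f B).1.2.
  by move=> BM; apply: contra => wB; apply/bigcupP; exists B.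
have LB B w : B \in M -> w \notin LM -> w \notin (f B).1.1.
  by move=> BM; apply: contra => wB; apply/bigcupP; exists B.
case/orP: uAL => [uA|/bigcupP[B BM uB]]; last first.
  by have [_ _ _ _ [h _]] := hf B BM; apply: h; rewrite ?XB ?LB.
apply/negP => uv; have [C CP vC] := good_part v gP.
have CA : C != A by apply: contra vA => /eqP <-.
have [vh'|CM] := hull_or_big AP CP CA uA vC uv; first by rewrite vh' in vh.
have [_ _ _ _ [_ h]] := hf C CM.
by move: uv; apply/negP; apply: h; rewrite ?XB ?LB.
Qed.

(** The first part with [k] elements of [W] arises by merging two parts with fewer than [k] each,
    hence has fewer than [2k]. Singletons are not heavy because [1 < k]. *)
Lemma first_heavy_part P A W k : reachable P -> A \in P -> 1 < k -> k <= #|W :&: A| ->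
  exists P' A', [/\ reachable P', A' \in P', k <= #|W :&: A'| < k.*2 &
    forall B, B \in P' -> B != A' -> #|W :&: B| < k].
Proof.
move=> rP + k1; elim: rP A => {P} [|P Q B C rP IH BP CP QP gQ] A.
  move=> /imsetP[x _ ->]; rewrite leqNgt; case: leqP => // + _.
  have := subset_leq_card (subsetIr W [set x]); rewrite cards1; lia.
move=> AQ kA.
have [/exists_inP[D DP kD]|] := boolP [exists D in P, k <= #|W :&: D|]; first exact: IH kD.
rewrite negb_exists_in => /forall_inP nP.
have nP' D : D \in P -> #|W :&: D| < k by move=> /nP; rewrite -ltnNge.
have eA : A = B :|: C.
  by have [/nP' ltA|//] := QP A AQ; have := leq_trans ltA kA; rewrite ltnn.
exists Q, A; split=> //; first exact: reach_merge rP BP CP QP gQ.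
  rewrite kA eA setIUr /=; have := nP' B BP; have := nP' C CP.
  have := (leq_card_setU (W :&: B) (W :&: C)).1; lia.
by move=> D /QP[/nP' //|->]; rewrite eA eqxx.
Qed.

(** With [k = 23t + 1], the side [L] has fewer than [2k] elements of [W] in [A] and at most [6k] in
    the arms, and the other side misses the [k] elements in [A]. The ninth [k] leaves room for the
    added [23t]. *)
Lemma balanced_separator P W : 0 < t -> reachable P -> [set: G] \in P ->
  #|W| = 9 * (23 * t).+1 ->
  exists L X, [/\ #|X| <= 23 * t, [disjoint L & X], anticomplete L (~: (L :|: X)),
    #|W :&: L| + 23 * t < #|W| & #|W :\: (L :|: X)| + 23 * t < #|W|].
Proof.
move=> t0 rP TP cW; set k := (23 * t).+1 in cW.
have [||P' [A [rP' AP /andP[kA A2k] small]]] := @first_heavy_part P [set: G] W k rP TP.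
- by rewrite /k; lia.
- by rewrite setIT; lia.
have bA : big t A.
  apply: leq_trans (subset_leq_card (subsetIr W A)); rewrite /k in kA; lia.
have [L [X [T [[TP' T6 cX AL LT] h]]]] := separator_around_part rP' AP bA.
have LX : L :\: X :|: X = L :|: X.
  by apply/setP => u; rewrite !inE; case: (u \in X); rewrite ?orbT.
exists (L :\: X), X; rewrite LX; split=> //.
- by rewrite -setI_eq0 setIDAC setDIl setDv setI0.
- apply/anticompleteP => u v /setDP[uL uX]; rewrite in_setC in_setU negb_or => /andP[vL vX].
  exact: h.
- have : #|W :&: cover T| <= #|T| * k.
    rewrite /cover big_distrr /=; apply: card_bigcup_leq => B BT; apply: ltnW.
    by have := subsetP TP' B BT; rewrite !inE => /andP[BA BP]; apply: small.
  have : #|W :&: (L :\: X)| <= #|W :&: A| + #|W :&: cover T|.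
    apply: leq_trans (leq_card_setU _ _); rewrite -setIUr.
    by apply: subset_leq_card; apply: setIS; apply: subset_trans (subsetDl _ _) LT.
  rewrite -/k in A2k *; nia.
have : #|W :\: (L :|: X)| <= #|W :\: A|.
  by apply: subset_leq_card; apply: setDS; apply: subset_trans AL (subsetUl _ _).
have := subset_leq_card (subsetIl W A); rewrite (cardsD W A); lia.
Qed.

End Separator.

(** * From contraction sequences to partition sequences *)

Section ContractionToPartitions.
Variable G : sgraph.

Definition parts (H : finType) (p : G -> H) : {set {set G}} :=
  [set p @^-1: [set a] | a in H].

(* H is the trigraph obtained from G by identifying the fibres of p, up to red
   edges between homogeneous pairs of fibres. *)
Definition quotient_trigraph (H : trigraph) (p : G -> H) :=
  (forall u v, p u != p v -> adj u v -> adj (p u) (p v)) /\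
  (forall u v, adj (p u) (p v) -> ~~ red (p u) (p v) -> adj u v).

Lemma mixed_fibres_red (H : trigraph) (p : G -> H) a b : quotient_trigraph p -> a != b ->
  mixed (p @^-1: [set a]) (p @^-1: [set b]) -> red a b.
Proof.
move=> [h1 h2] ab; apply: contraTT => nr; rewrite negb_and !negbK.
have [ad|nad] := boolP (adj a b); apply/orP; [left|right].
- apply/completeP => u v; rewrite !inE => /eqP ua /eqP vb.
  by apply: h2; rewrite ua vb.
- apply/anticompleteP => u v; rewrite !inE => /eqP ua /eqP vb.
  by apply: contra nad => uv; rewrite -ua -vb; apply: h1; rewrite ?ua ?vb.
Qed.

Lemma parts_good (H : trigraph) (p : G -> H) :
  quotient_trigraph p -> max_red_degree H <= 2 -> good (parts p).
Proof.
move=> hp H2; apply/and3P; split.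
- apply/eqP/setP => v; rewrite inE; apply/bigcupP; exists (p @^-1: [set p v]).
    exact: imset_f.
  by rewrite !inE.
- apply/trivIsetP => _ _ /imsetP[a _ ->] /imsetP[b _ ->] ab.
  rewrite -setI_eq0 -preimsetI; have [eab|nab] := eqVneq a b; first by rewrite eab eqxx in ab.
  rewrite (_ : _ :&: _ = set0) ?preimset0 //; apply/setP => x; rewrite !inE.
  by apply/negP => /andP[/eqP-> ]; rewrite (negbTE nab).
- apply/forall_inP => _ /imsetP[a _ ->].
  apply: leq_trans (leq_trans (leq_imset_card (fun b => p @^-1: [set b]) (red_nbr a)) _).
    apply: subset_leq_card; apply/subsetP => B; rewrite inE.
    case/and3P => /imsetP[b _ ->] ab m; apply: imset_f; rewrite inE.
    by apply: mixed_fibres_red hp _ m; apply: contra ab => /eqP->.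
  by apply: leq_trans H2; exact: (leq_bigmax a).
Qed.

(** [insub] is [None], the new vertex, exactly at [x1] and [x2]. *)
Definition contract_map (H : trigraph) (x1 x2 : H) (z : H) : contract x1 x2 := insub z.

Lemma quotient_contract (H : trigraph) (p : G -> H) (x1 x2 : H) :
  quotient_trigraph p -> quotient_trigraph (@contract_map H x1 x2 \o p).
Proof.
move=> [h1 h2].
have inx z : ~~ ((z != x1) && (z != x2)) -> z = x1 \/ z = x2.
  by rewrite negb_and !negbK => /orP[] /eqP; [left|right].
have nbrE u v : p u != x1 -> p u != x2 -> p v = x1 \/ p v = x2 -> adj u v ->
    p u \in contract_nbr x1 x2.
  move=> n1 n2 hv uv; rewrite !inE !(adj_sym _ (p u)).
  by case: hv => hv; rewrite -hv h1 ?orbT // hv.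
(* A black edge at the new vertex comes from black edges to both [x1] and [x2]. *)
have redE u v : p v = x1 \/ p v = x2 -> p u \in contract_nbr x1 x2 ->
    p u \notin contract_red_nbr x1 x2 -> adj u v.
  rewrite !inE !(adj_sym _ (p u)) !(red_sym _ (p u)) => hv.
  move=> a; rewrite !negb_or => /and3P[/andP[r1 r2] d1 d2].
  have [a1 a2] : adj (p u) x1 /\ adj (p u) x2.
    by move: a d1 d2; do 2!case: (adj (p u) _).
  by apply: h2; case: hv => ->.
split=> u v /=; rewrite /contract_map.
- case: insubP => [a /andP[u1 u2] au|/inx hu]; case: insubP => [b /andP[v1 v2] bv|/inx hv] //=.
  + by move=> ab uv; rewrite au bv h1 // -au -bv; apply: contra ab => /eqP/val_inj->.
  + by move=> _ uv; rewrite au; exact: nbrE hv uv.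
  + by move=> _; rewrite adj_sym bv => uv; exact: nbrE hu uv.
- case: insubP => [a /andP[u1 u2] au|/inx hu]; case: insubP => [b /andP[v1 v2] bv|/inx hv] //=.
  + by rewrite au bv; exact: h2.
  + by rewrite au; exact: redE.
  + by rewrite bv adj_sym; exact: redE.
Qed.

Lemma parts_contract (H : trigraph) (p : G -> H) (x1 x2 : H) C :
  C \in parts (@contract_map H x1 x2 \o p) ->
  C \in parts p \/ C = p @^-1: [set x1] :|: p @^-1: [set x2].
Proof.
case/imsetP => [[a|] _ ->]; [left|right].
  apply/imsetP; exists (val a) => //; apply/setP => u; rewrite !inE /contract_map /=.
  case: insubP => [b _ <-|]; first by apply/eqP/eqP => [[->]|/val_inj->].
  by move=> n; apply/esym/negbTE; apply: contra n => /eqP->; exact: (valP a).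
apply/setP => u; rewrite !inE /contract_map /=.
by case: insubP => [b /andP[/negbTE-> /negbTE->]|]; rewrite // negb_and !negbK => ->.
Qed.

Lemma contraction_reachable (H : trigraph) (s : contraction_seq H) (p : G -> H) :
  quotient_trigraph p -> reachable (parts p) -> cseq_width s <= 2 ->
  exists2 P : {set {set G}}, reachable P & [set: G] \in P.
Proof.
elim: s p => {H} [H H1|H x1 x2 x12 s IH] p hp rp /=.
  move=> _; exists (parts p) => //; have /card_gt0P[a _] : 0 < #|H| by rewrite H1.
  apply/imsetP; exists a => //; apply/setP => u; rewrite !inE.
  by have /fintype_le1P/(_ a (p u)) -> : #|H| <= 1; rewrite ?H1 ?eqxx.
rewrite geq_max => /andP[_ sw]; apply: (IH (@contract_map H x1 x2 \o p)) => //.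
  exact: quotient_contract.
apply: (reach_merge (A := p @^-1: [set x1]) (B := p @^-1: [set x2]) rp) => [||C|].
- exact: imset_f.
- exact: imset_f.
- exact: parts_contract.
apply: parts_good; first exact: quotient_contract.
(* Whichever constructor [s] has, its width bounds the red degree of the trigraph it starts from. *)
by case: s sw {IH} => [K _ /=|K y1 y2 y12 s /=] => //; rewrite geq_max => /andP[].
Qed.

Lemma twin_width_reachable : 0 < #|G| -> twin_width G <= 2 ->
  exists2 P : {set {set G}}, reachable P & [set: G] \in P.
Proof.
move=> G0; rewrite /twin_width /twin_width_tri.
set S := (fun w => _); have [s0] := @contraction_seq_exists (trigraph_of G) G0.
(* As [G] is nonempty, the minimum is attained by a sequence and is not the default 0 of [least]. *)
have [|[s sw] _] := @leastP S; first by exists (cseq_width s0), s0.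
rewrite -sw; apply: (@contraction_reachable _ s id).
  by split.
rewrite (_ : parts _ = [set [set x] | x in G]); first exact: reach_singletons.
by apply: eq_imset => x; apply/setP => y; rewrite !inE.
Qed.

End ContractionToPartitions.

(** * From balanced separators to tree-width *)

Section ParentTree.
Variables (n : nat) (par : 'I_n.+1 -> 'I_n.+1).
Hypothesis par_gt : forall i : 'I_n.+1, i < n -> i < par i.

(** The comparison of indices discards the value of [par] at the last index, which is the root. *)
Definition parent_adj (i j : 'I_n.+1) :=
  (i < j) && (par i == j) || (j < i) && (par j == i).

Fact parent_adj_sym : symmetric parent_adj.
Proof. by move=> i j; rewrite /parent_adj orbC. Qed.

Fact parent_adj_irr : irreflexive parent_adj.
Proof. by move=> i; rewrite /parent_adj ltnn. Qed.

Definition parent_graph := SGraph parent_adj_sym parent_adj_irr.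

Lemma parent_adj_par (i : 'I_n.+1) : i < n -> parent_adj i (par i).
Proof. by move=> ltin; rewrite /parent_adj par_gt ?eqxx. Qed.

(** Each step to the parent raises the index and none passes [m], so the walk ends at [m]. *)
Lemma parent_connect (e : rel 'I_n.+1) (m : 'I_n.+1) (Q : pred 'I_n.+1) :
  (forall i, Q i -> i <= m) ->
  (forall i, Q i -> i < m -> e i (par i) && Q (par i)) ->
  forall i, Q i -> connect e i m.
Proof.
move=> Qm step i; have [k] := ubnP (m - i); elim: k i => // k IH i ltk Qi.
have := Qm i Qi; rewrite leq_eqVlt => /orP[/eqP/val_inj->|ltim]; first exact: connect0.
have /andP[ei Qp] := step i Qi ltim; apply: connect_trans (connect1 ei) (IH _ _ Qp).
have := par_gt (leq_trans ltim (leq_ord m)); lia.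
Qed.

(* In a cycle, both neighbours of the node of least index are its parent. *)
Lemma parent_graph_tree : is_tree parent_graph.
Proof.
split; first by rewrite card_ord.
  have toroot i : connect parent_adj i ord_max.
    apply: (@parent_connect _ _ predT) => // [j _|j _ ltj]; first exact: leq_ord.
    by rewrite parent_adj_par.
  move=> i j; apply: connect_trans (toroot i) _.
  by rewrite (sym_connect_sym parent_adj_sym); exact: toroot.
move=> c c3 /andP[cyc uc]; have i0 : 'I_n.+1 by exact: ord0.
have /hasP[i1 i1c _] : has predT c by rewrite has_predT (ltn_trans _ c3).
case: (arg_minnP (P := [in c]) (fun i : 'I_n.+1 => i) i1c) => i ic imin.
have [k s rc] := rot_to ic.
have min j : j \in s -> i <= j.
  by move=> js; apply: imin; rewrite /= -(mem_rot k) rc inE js orbT.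
have us : uniq (i :: s) by rewrite -rc rot_uniq.
have : cycle parent_adj (i :: s) by rewrite -rc rot_cycle.
have : 2 < size (i :: s) by rewrite -rc size_rot.
case: s min us {rc} => // x s min; case/lastP: s min => // s y min /= us _.
rewrite rcons_path last_rcons => /and3P[ix _ yi].
have up j : j \in x :: rcons s y -> parent_adj i j -> par i = j.
  move=> js; rewrite /parent_adj => /orP[/andP[_ /eqP//]|/andP[]].
  by rewrite ltnNge min.
have yp : par i = y.
  by apply: up; rewrite ?inE ?mem_rcons ?mem_head ?orbT // parent_adj_sym.
by move: us; rewrite -(up x (mem_head _ _) ix) yp mem_rcons mem_head /= andbF.
Qed.

(** Let [m] be the last index whose bag contains [x]. Any earlier bag with [x] shares it with bag
    [m], hence passes it to its parent, so all bags with [x] are connected to [m]. *)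
Lemma parent_tree_decomposition (G : sgraph) (bag : 'I_n.+1 -> {set G}) (w : nat) :
  (forall i j : 'I_n.+1, i < j -> bag i :&: bag j \subset bag (par i)) ->
  (forall x, exists i, x \in bag i) ->
  (forall x y, adj x y -> exists i, (x \in bag i) && (y \in bag i)) ->
  (forall i, #|bag i| <= w.+1) -> tree_width G <= w.
Proof.
move=> sub bv be bw.
have subtree (x : G) (i j : parent_graph) : x \in bag i -> x \in bag j ->
    connect [rel k l : parent_graph | [&& adj k l, x \in bag k & x \in bag l]] i j.
  set e := [rel k l : parent_graph | _] => xi xj.
  have se : connect_sym e.
    apply: sym_connect_sym => k l.
    by rewrite /e /= parent_adj_sym [(x \in bag k) && _]andbC.
  case: (arg_maxnP (P := [pred k | x \in bag k]) (fun k : 'I_n.+1 => k) xi) => m xm mmax.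
  have tom k : x \in bag k -> connect e k m.
    apply: (@parent_connect e m [pred k | x \in bag k]) => [k' /mmax//|k' /= xk ltk].
    have xp : x \in bag (par k') by apply: (subsetP (sub _ _ ltk)); rewrite inE xk.
    by rewrite xk xp !andbT; apply: parent_adj_par; exact: leq_trans ltk (leq_ord m).
  by apply: connect_trans (tom i xi) _; rewrite se; exact: tom.
pose D := @TreeDecomposition G parent_graph bag parent_graph_tree bv be subtree.
have [|_ minw] := @leastP (fun v => exists D : tree_decomposition G, td_width D = v).
  by exists (td_width D), D.
apply: leq_trans (minw (td_width D) _) _; first by exists D.
by rewrite /td_width -subn1 leq_subLR add1n; apply/bigmax_leqP => i _; exact: bw.
Qed.

End ParentTree.

Section RunningIntersection.
Variable G : sgraph.
Implicit Types (bs : seq {set G}) (U W L X b : {set G}).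

(* The most recently added bag is the head of the list. *)
Fixpoint running_intersection bs : Prop :=
  if bs is b :: bs' then
    (bs' <> [::] -> exists2 b', b' \in bs' & forall c, c \in bs' -> b :&: c \subset b')
      /\ running_intersection bs'
  else True.

(** Older bags stand further down the list, so the bag to which a new one is attached has the larger
    index required of a parent. *)
Lemma running_intersection_nth bs i : running_intersection bs -> i.+1 < size bs ->
  exists2 k, i < k < size bs &
    forall j, i < j < size bs -> nth set0 bs i :&: nth set0 bs j \subset nth set0 bs k.
Proof.
elim: bs i => // b bs IH [|i] /= [h rbs] lti.
  have [|b' b'bs sub] := h; first by case: bs lti {IH h rbs}.
  exists (index b' bs).+1; first by rewrite /= ltnS index_mem.
  by case=> // j; rewrite /= ltnS => ltj; rewrite nth_index // sub // mem_nth.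
have [k ltk sub] := IH i rbs lti; exists k.+1; first by rewrite !ltnS.
by case=> // j; rewrite !ltnS; exact: sub.
Qed.

Lemma running_intersection_tree_width bs w : bs <> [::] -> running_intersection bs ->
  (forall x : G, exists2 b, b \in bs & x \in b) ->
  (forall x y : G, adj x y -> exists2 b, b \in bs & (x \in b) && (y \in b)) ->
  (forall b, b \in bs -> #|b| <= w.+1) -> tree_width G <= w.
Proof.
case: bs => // b0 bs0 _; set bs := b0 :: bs0; set n := size bs0 => rbs bv be bw.
have parP (i : 'I_n.+1) : exists k : 'I_n.+1, (i < n -> i < k) /\
    forall j : 'I_n.+1, i < j -> nth set0 bs i :&: nth set0 bs j \subset nth set0 bs k.
  have [lti|gei] := ltnP i n; last first.
    (* The oldest bag is the root; no index exceeds its own, so any value would do. *)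
    by exists i; split=> // j ltij; have := leq_ord j; lia.
  have [|k /andP[ltik ltk] sub] := @running_intersection_nth bs i rbs; first by rewrite /= ltnS.
  by exists (Ordinal (ltk : k < n.+1)); split=> // j ltij; rewrite sub // ltij /=.
have [par hpar] := fin_all_exists parP.
have ix b : b \in bs -> exists i : 'I_n.+1, nth set0 bs i = b.
  by move=> bbs; have := bbs; rewrite -index_mem => ltb; exists (Ordinal ltb); rewrite nth_index.
have par_gt (i : 'I_n.+1) : i < n -> i < par i by case: (hpar i).
apply: (parent_tree_decomposition par_gt (bag := fun i : 'I_n.+1 => nth set0 bs i)).
- by move=> i; case: (hpar i).
- by move=> x; have [b /ix[i <-] xb] := bv x; exists i.
- by move=> x y /be[b /ix[i <-] xyb]; exists i.
- by move=> i; apply: bw; rewrite mem_nth.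
Qed.

Section Recursion.
Variables K s : nat.
Hypothesis separator : forall W, #|W| = K -> exists L X,
  [/\ #|X| <= s, [disjoint L & X], anticomplete L (~: (L :|: X)),
    #|W :&: L| + s < K & #|W :\: (L :|: X)| + s < K].

(** The Robertson-Seymour recursion: [U] remains to be decomposed and the interface [W] contains all
    its vertices in earlier bags. Once [W] is enlarged to a [K]-set [V], the bag [b0] made of [V]
    and its separator leaves two subproblems with interfaces inside [b0]. *)
Lemma extend_running_intersection U W bs : W \subset U -> #|W| <= K ->
  running_intersection bs ->
  (forall c, c \in bs -> U :&: c \subset W) ->
  (bs <> [::] -> exists2 b, b \in bs & W \subset b) ->
  exists bs', [/\ running_intersection (bs' ++ bs), bs' <> [::],
    forall b, b \in bs' -> (b \subset U) && (#|b| <= K + s),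
    forall x, x \in U -> exists2 b, b \in bs' & x \in b &
    forall x y, x \in U -> y \in U -> adj x y -> exists2 b, b \in bs' & (x \in b) && (y \in b)].
Proof.
have [m] := ubnP #|U|; elim: m U W bs => // m IH U W bs ltU WU cW rbs Ubs Wb.
have [leU|ltK] := leqP #|U| K.
  exists [:: U]; split=> //=.
  - by split=> // /Wb[b bbs sWb]; exists b => // c cbs; exact: subset_trans (Ubs c cbs) sWb.
  - by move=> b; rewrite inE => /eqP->; rewrite subxx; lia.
  - by move=> x xU; exists U; rewrite ?inE.
  - by move=> x y xU yU _; exists U; rewrite ?inE // xU.
have [V [WV VU cV]] : exists V : {set G}, [/\ W \subset V, V \subset U & #|V| = K].
  have [n] := ubnP (K - #|W|); elim: n W WU cW {Ubs Wb} => // n IHn W WU cW ltn.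
  have := cW; rewrite leq_eqVlt => /orP[/eqP eW|ltW]; first by exists W.
  have /card_gt0P[x] : 0 < #|U :\: W| by rewrite cardsD (setIidPr WU); lia.
  rewrite inE => /andP[xW xU].
  have [|||V [sV VU cV]] := IHn (x |: W); rewrite ?cardsU1 ?xW //.
  - by rewrite subUset sub1set xU.
  - by rewrite add1n; lia.
  by exists V; split=> //; apply: subset_trans sV; exact: subsetUr.
have [L [X [cX dLX /anticompleteP aL cL cR]]] := separator cV.
pose b0 := V :|: (X :&: U).
have b0U : b0 \subset U by rewrite subUset VU subsetIr.
have cb0 : #|b0| <= K + s.
  have := (leq_card_setU V (X :&: U)).1; have := subset_leq_card (subsetIl X U); rewrite -/b0; lia.
have rb0 : running_intersection (b0 :: bs).
  split=> // /Wb[b bbs sWb]; exists b => // c cbs.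
  by apply: subset_trans sWb; apply: subset_trans (Ubs c cbs); exact: setSI.
have Wb0 : W \subset b0 by apply: subset_trans WV _; exact: subsetUl.
have cV' : #|V| = #|V :&: L| + #|V :&: X| + #|V :\: (L :|: X)|.
  rewrite -(cardsID (L :|: X) V) setIUr cardsU.
  rewrite (_ : V :&: L :&: (V :&: X) = set0) ?cards0 ?subn0 //.
  apply/setP => x; rewrite !inE; apply/negP => /andP[/andP[_ xL] /andP[_ xX]].
  by have /pred0P/(_ x) := dLX; rewrite /= xL xX.
have cVX := subset_leq_card (subsetIr V X).
(* The new interface consists of [V :&: A] and at most [s] vertices of [X]. *)
have cside (A : {set G}) : [disjoint A & X] -> #|V :&: A| + s < K ->
    #|b0 :&: (A :|: X)| <= K.
  move=> dA cA; have sub : b0 :&: (A :|: X) \subset (V :&: A) :|: X.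
    by apply/subsetP => x; rewrite !inE; do !case: (x \in _).
  have := subset_leq_card sub; have := (leq_card_setU (V :&: A) X).1; lia.
pose R := ~: (L :|: X).
have dRX : [disjoint R & X].
  by rewrite -setI_eq0; apply/eqP/setP => x; rewrite !inE; case: (x \in X); rewrite ?orbT ?andbF.
have VR : V :&: R = V :\: (L :|: X) by rewrite /R setDE.
(* Each side together with [X] contains fewer than [K] vertices of [V], so [V] meets the opposite
   side and the recursive calls are on smaller sets. *)
have proper (A B : {set G}) : [disjoint B & A :|: X] -> 0 < #|V :&: B| -> #|U :&: (A :|: X)| < m.
  move=> dB /card_gt0P[x /setIP[xV xB]].
  suff : U :&: (A :|: X) \proper U by move=> /proper_card lt; exact: leq_trans lt ltU.
  apply/properP; split; first exact: subsetIl.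
  exists x; first exact: (subsetP VU).
  by rewrite inE (disjointFr dB xB) andbF.
have [||||||bs1 [r1 n1 h1 v1 e1]] := IH (U :&: (L :|: X)) (b0 :&: (L :|: X)) (b0 :: bs).
- apply: (proper L R); last by rewrite VR; lia.
  by rewrite /R disjoints_subset subxx.
- exact: setSI.
- exact: cside.
- exact: rb0.
- move=> c; rewrite inE => /orP[/eqP->|cbs].
    by rewrite setIAC setSI // subsetIr.
  apply/subsetP => x /setIP[/setIP[xU xLX] xc]; rewrite inE xLX andbT.
  by apply: (subsetP Wb0); apply: (subsetP (Ubs c cbs)); rewrite inE xU.
- by move=> _; exists b0; [exact: mem_head|exact: subsetIl].
have b0bs1 : b0 \in bs1 ++ b0 :: bs by rewrite mem_cat mem_head orbT.
have [||||||bs2 [r2 n2 h2 v2 e2]] :=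
  IH (U :&: (R :|: X)) (b0 :&: (R :|: X)) (bs1 ++ b0 :: bs).
- apply: (proper R L); last by lia.
  rewrite disjoint_sym -setI_eq0; apply/eqP/setP => x; rewrite !inE.
  have /pred0P/(_ x) := dLX; rewrite /=.
  by case: (x \in L); case: (x \in X).
- exact: setSI.
- by apply: cside; rewrite ?VR.
- exact: r1.
- move=> c; rewrite mem_cat inE => /or3P[cbs1|/eqP->|cbs].
  (* Bags of the first call stay in [L :|: X], so they meet the second subproblem only in [X :&: U],
     which lies in [b0]. *)
  + have /andP[cU _] := h1 c cbs1; apply/subsetP => x /setIP[/setIP[xU xRX] xc].
    have /setIP[_ xLX] := subsetP cU x xc.
    have xX : x \in X by move: xRX xLX; rewrite !inE; case: (x \in L); case: (x \in X).
    by rewrite in_setI xRX andbT !inE xX xU orbT.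
  + by rewrite setIAC setSI // subsetIr.
  + apply/subsetP => x /setIP[/setIP[xU xLX] xc]; rewrite inE xLX andbT.
    by apply: (subsetP Wb0); apply: (subsetP (Ubs c cbs)); rewrite inE xU.
- by move=> _; exists b0 => //; exact: subsetIl.
have inside x : (x \in L :|: X) || (x \in R :|: X).
  by rewrite !inE; case: (x \in L); case: (x \in X).
exists (bs2 ++ bs1 ++ [:: b0]); split.
- by rewrite -!catA.
- by case: (bs2) n2.
- move=> b; rewrite !mem_cat inE => /or3P[/h2|/h1|/eqP->]; last by rewrite b0U.
  + by case/andP => /subset_trans/(_ (subsetIl _ _)) ->.
  + by case/andP => /subset_trans/(_ (subsetIl _ _)) ->.
- move=> x xU; case/orP: (inside x) => xi.
  + have [b bb xb] := v1 x (etrans (in_setI _ _ _) (introT andP (conj xU xi))).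
    by exists b; rewrite // !mem_cat bb orbT.
  + have [b bb xb] := v2 x (etrans (in_setI _ _ _) (introT andP (conj xU xi))).
    by exists b; rewrite // !mem_cat bb.
move=> x y xU yU xy.
(* No edge joins [L] to [R], so both ends of the edge lie in a common subproblem. *)
have /orP[/andP[xi yi]|/andP[xi yi]] : (x \in L :|: X) && (y \in L :|: X) ||
    (x \in R :|: X) && (y \in R :|: X).
  apply/negP => /negP; rewrite negb_or !negb_and => /andP[nL nR].
  have notin z : z \notin R :|: X -> z \in L.
    by rewrite !inE; case: (z \in L); case: (z \in X).
  have notin' z : z \notin L :|: X -> z \in R by rewrite !inE.
  move: (inside x) (inside y) nL nR => + + /orP[] nx /orP[] ny.
  all: rewrite ?(negbTE nx) ?(negbTE ny) //.
  + by have := aL y x (notin _ ny) (notin' _ nx); rewrite adj_sym xy.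
  + by have := aL x y (notin _ ny) (notin' _ nx); rewrite xy.
- have [||b bb xyb] := e1 x y _ _ xy; rewrite 1?in_setI ?xU ?yU //.
  by exists b; rewrite // !mem_cat bb orbT.
- have [||b bb xyb] := e2 x y _ _ xy; rewrite 1?in_setI ?xU ?yU //.
  by exists b; rewrite // !mem_cat bb.
Qed.

Lemma separators_tree_width : tree_width G <= K + s.
Proof.
have [|||||bs [rbs nbs cbs bv be]] := @extend_running_intersection [set: G] set0 [::].
- exact: sub0set.
- by rewrite cards0.
- by [].
- by [].
- by [].
rewrite cats0 in rbs; apply: (running_intersection_tree_width nbs rbs).
- by move=> x; apply: bv; rewrite inE.
- by move=> x y; apply: be; rewrite inE.
- by move=> b /cbs/andP[_]; lia.
Qed.

End Recursion.
End RunningIntersection.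

(** * A linear bound on tree-width *)

Lemma twin_width2_tree_width (G : sgraph) t : 0 < t -> twin_width G <= 2 ->
  ~ is_subgraph (complete_bipartite t) G -> tree_width G <= 240 * t.
Proof.
move=> t0 tww noK; have : 9 * (23 * t).+1 + 23 * t <= 240 * t by lia.
apply: leq_trans; apply: separators_tree_width => W cW.
(* Separators are only requested for sets of positive size, so the empty graph, which has no
   contraction sequence, does not arise. *)
have G0 : 0 < #|G| by apply: leq_trans (max_card (mem W)); rewrite cW.
have [P rP TP] := twin_width_reachable G0 tww.
by have := balanced_separator noK t0 rP TP cW; rewrite cW.
Qed.

From mathcomp Require Import all_boot all_order all_algebra.
From mathcomp Require Import all_classical all_reals all_analysis.
Import Order.TTheory GRing.Theory Num.Theory.
Import numFieldNormedType.Exports.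
Local Open Scope classical_set_scope.
Local Open Scope ring_scope.

Theorem theorem1p2 (R : realType) :
  exists f : nat -> R,
    f =O_\oo (fun t : nat => t%:R ^+ 20 : R) /\
    forall t : nat, (0 < t)%N ->
    forall C : sgraph -> Prop,
      (forall G : sgraph, C G -> (twin_width G <= 2)%N) ->
      (forall G : sgraph, C G -> ~ is_subgraph (complete_bipartite t) G) ->
      forall G : sgraph, C G -> (tree_width G)%:R <= f t.
Proof.
have leX n : (n <= n ^ 20)%N by case: n => // n; rewrite -[leqLHS]expn1 leq_pexp2l.
(* The linear bound is $O(t^{20})$ with constant 240, because [t <= t ^ 20] for every natural
   number. *)
exists (fun t => (240 * t)%:R); split.
  apply/eqO_exP; exists 240; first by rewrite ltr0n.
  near=> t; rewrite ger0_norm ?ler0n // ger0_norm ?exprn_ge0 ?ler0n //.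
  rewrite natrM ler_wpM2l ?ler0n // -natrX ler_nat.
  exact: leX.
move=> t t0 C tww noK G CG; rewrite ler_nat.
exact: twin_width2_tree_width t0 (tww G CG) (noK G CG).
Unshelve. all: by end_near.
Qed.
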